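(* Let $E$ be an order continuous rearrangement invariant Banach function space on $[0,1]$ (with Lebesgue measure). Then the Cesàro function space $[\mathcal{C},E]$ is weakly almost square (WASQ).
   Context: All Banach spaces are real. For a Banach space $X$, $B_X$ and $S_X$ denote its closed unit ball and unit sphere. WASQ: a Banach space $X$ is weakly almost square (WASQ) if for every $x\in S_X$ there is a weakly null sequence $(y_n)_{n\in\mathbb{N}}$ in $B_X$ such that $\|x+y_n\|\to 1$, $\|x-y_n\|\to 1$ and $\|y_n\|\to 1$. Banach function space: for a finite measure space $(\Omega,\Sigma,\mu)$, a Banach space $(E,\|\cdot\|)$ is a Banach function space on $(\Omega,\Sigma,\mu)$ if (a) $E$ is a (not necessarily closed) linear subspace of $L_1(\mu)$; (b) if $f\in L_0(\mu)$ and $|f|\le|g|$ $\mu$-a.e. for some $g\in E$, then $f\in E$ and $\|f\|\le\|g\|$; (c) $\chi_A\in E$ for each $A\in\Sigma$. It is a Banach lattice with the $\mu$-a.e. order. A Banach function space on $[0,1]$ is one on $[0,1]$ with the Lebesgue $\sigma$-algebra and Lebesgue measure. It is rearrangement invariant if, whenever $g\in E$ and $f$ is a measurable function such that $|f|$ and $|g|$ have the same distribution function, then $f\in E$ and $\|f\|=\|g\|$. Order continuity is the usual notion for Banach lattices (every downward directed net with infimum $0$ converges to $0$ in norm). Cesàro function space: for $f\in L_1[0,1]$ put $\mathcal{C}(f)(x):=\frac1x\int_0^x f(t)\,dt$. Given a rearrangement invariant Banach function space $(E,\|\cdot\|_E)$ on $[0,1]$, $[\mathcal{C},E]$ is the Banach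 function space on $[0,1]$ consisting of all $f\in L_1[0,1]$ with $\mathcal{C}(|f|)\in E$, equipped with the norm $\|f\|_{[\mathcal{C},E]}:=\|\mathcal{C}(|f|)\|_E$. *)

(* Defs.v *)
From HB Require Import structures.
From mathcomp Require Import all_boot all_order all_algebra.
From mathcomp Require Import all_classical all_reals all_analysis.
From mathcomp Require Import measurable_realfun.

Set Implicit Arguments.
Unset Strict Implicit.
Unset Printing Implicit Defensive.

Import Order.TTheory GRing.Theory Num.Theory.
Import numFieldNormedType.Exports.

Local Open Scope classical_set_scope.
Local Open Scope ring_scope.

(* L_0(mu) is the library's quotient {mfun_ mu, T >-> R} of the measurable
   functions by a.e. equality; an element coerces to a representative, so only
   a.e. statements about it are meaningful. *)
Section L0.
Context {d} {T : measurableType d} {R : realType}.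
Variable mu : {measure set T -> \bar R}.
Local Open Scope quotient_scope.

Local Notation L0 := {mfun_ mu, T >-> R}.
Implicit Types (f g h : L0) (u v : {mfun T >-> R}) (a b : R).

Definition L0_pi u : L0 := \pi_L0 u.

Lemma L0_piE u : \forall x \ae mu, L0_pi u x = u x.
Proof.
have : L0_pi (repr (L0_pi u)) = L0_pi u by rewrite /L0_pi reprK.
by move/eqP; rewrite /L0_pi eqmodE => /asboolP; apply: filterS => x; apply.
Qed.

Lemma L0P f g : f = g <-> \forall x \ae mu, f x = g x.
Proof.
split=> [->|fg]; first exact/aeW.
rewrite -[f]reprK -[g]reprK; apply/eqP; rewrite eqmodE; apply/asboolP.
by apply: filterS fg.
Qed.

Definition L0_zero := L0_pi 0.
Definition L0_add f g := L0_pi (repr f + repr g).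
Definition L0_opp f := L0_pi (- repr f).
Definition L0_scale a f := L0_pi (a *: repr f).

Lemma L0_zeroE : \forall x \ae mu, L0_zero x = 0.
Proof. exact: L0_piE. Qed.
Lemma L0_addE f g : \forall x \ae mu, L0_add f g x = f x + g x.
Proof. exact: L0_piE. Qed.
Lemma L0_oppE f : \forall x \ae mu, L0_opp f x = - f x.
Proof. exact: L0_piE. Qed.
Lemma L0_scaleE a f : \forall x \ae mu, L0_scale a f x = a * f x.
Proof. exact: L0_piE. Qed.

Lemma L0_addA : associative L0_add.
Proof.
move=> f g h; apply/L0P; near=> x.
have -> : L0_add f (L0_add g h) x = f x + L0_add g h x.
  by near: x; exact: L0_addE.
have -> : L0_add g h x = g x + h x by near: x; exact: L0_addE.
have -> : L0_add (L0_add f g) h x = L0_add f g x + h x.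
  by near: x; exact: L0_addE.
have -> : L0_add f g x = f x + g x by near: x; exact: L0_addE.
exact: addrA.
Unshelve. all: by end_near. Qed.

Lemma L0_addC : commutative L0_add.
Proof. by move=> f g; rewrite /L0_add addrC. Qed.

Lemma L0_add0 : left_id L0_zero L0_add.
Proof.
move=> f; apply/L0P; move: L0_zeroE (L0_addE L0_zero f); apply: filterS2 => x.
by move=> f0 ->; rewrite f0 add0r.
Qed.

Lemma L0_addN : left_inverse L0_zero L0_opp L0_add.
Proof.
move=> f; apply/L0P; move: L0_zeroE (L0_addE (L0_opp f) f) (L0_oppE f).
by apply: filterS3 => x -> -> ->; rewrite addNr.
Qed.

HB.instance Definition _ :=
  GRing.isZmodule.Build L0 L0_addA L0_addC L0_add0 L0_addN.

Lemma L0_scaleA a b f : L0_scale a (L0_scale b f) = L0_scale (a * b) f.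
Proof.
apply/L0P; move: (L0_scaleE a (L0_scale b f)) (L0_scaleE b f)
  (L0_scaleE (a * b) f).
by apply: filterS3 => x -> -> ->; rewrite mulrA.
Qed.

Lemma L0_scale1 : left_id 1 L0_scale.
Proof.
move=> f; apply/L0P; apply: filterS (L0_scaleE 1 f) => x ->.
by rewrite mul1r.
Qed.

Lemma L0_scaleDr : right_distributive L0_scale +%R.
Proof.
move=> a f g; apply/L0P; near=> x.
have -> : L0_scale a (f + g : L0) x = a * (f + g : L0) x.
  by near: x; exact: L0_scaleE.
have -> : (f + g : L0) x = f x + g x by near: x; exact: L0_addE.
have -> : (L0_scale a f + L0_scale a g : L0) x = L0_scale a f x + L0_scale a g x.
  by near: x; exact: L0_addE.
have -> : L0_scale a f x = a * f x by near: x; exact: L0_scaleE.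
have -> : L0_scale a g x = a * g x by near: x; exact: L0_scaleE.
exact: mulrDr.
Unshelve. all: by end_near. Qed.

Lemma L0_scaleDl f : {morph L0_scale^~ f : a b / a + b}.
Proof.
move=> a b; apply/L0P; near=> x.
have -> : (L0_scale a f + L0_scale b f : L0) x = L0_scale a f x + L0_scale b f x.
  by near: x; exact: L0_addE.
have -> : L0_scale (a + b) f x = (a + b) * f x.
  by near: x; exact: L0_scaleE.
have -> : L0_scale a f x = a * f x by near: x; exact: L0_scaleE.
have -> : L0_scale b f x = b * f x by near: x; exact: L0_scaleE.
exact: mulrDl.
Unshelve. all: by end_near. Qed.

HB.instance Definition _ := GRing.Zmodule_isLmodule.Build R L0
  L0_scaleA L0_scale1 L0_scaleDr L0_scaleDl.

Lemma L00E : \forall x \ae mu, (0 : L0) x = 0.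
Proof. exact: L0_zeroE. Qed.
Lemma L0DE f g : \forall x \ae mu, (f + g : L0) x = f x + g x.
Proof. exact: L0_addE. Qed.
Lemma L0NE f : \forall x \ae mu, (- f : L0) x = - f x.
Proof. exact: L0_oppE. Qed.
Lemma L0ZE a f : \forall x \ae mu, (a *: f : L0) x = a * f x.
Proof. exact: L0_scaleE. Qed.

Definition L0_abs f : L0 := L0_pi (Num.norm \o repr f).
Lemma L0_absE f : \forall x \ae mu, L0_abs f x = `|f x|.
Proof. exact: L0_piE. Qed.

Definition L0_indic (A : set T) (mA : measurable A) : L0 := L0_pi (mindic R mA).

Definition L0_le f g := \forall x \ae mu, f x <= g x.

Definition in_L1 f := mu.-integrable [set: T] (EFin \o f).

Lemma in_L1_pi u : mu.-integrable [set: T] (EFin \o u) -> in_L1 (L0_pi u).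
Proof.
move=> /integrableP[mu_ uoo]; apply/integrableP; split.
  exact/measurable_EFinP.
rewrite (_ : (\int[mu]_x _ = \int[mu]_x `|(EFin \o u) x|)%E)//.
apply: ge0_ae_eq_integral => //.
- by apply: measurableT_comp => //; exact/measurable_EFinP.
- by apply: measurableT_comp.
- by apply: filterS (L0_piE u) => x /= ->.
Qed.

End L0.

(* The carrier of the norm is all of L_0; its values outside nfs_set are
   irrelevant. *)
Record normed_fun_space d (T : measurableType d) (R : realType)
    (mu : {measure set T -> \bar R}) := NormedFunSpace {
  nfs_set : {pred {mfun_ mu, T >-> R}};
  nfs_norm : {mfun_ mu, T >-> R} -> R;
  nfs_submod_closed : submod_closed nfs_set;
  nfs_ler_normD : {in nfs_set &, forall f g,
    nfs_norm (f + g) <= nfs_norm f + nfs_norm g};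
  nfs_normZ : forall a, {in nfs_set, forall f,
    nfs_norm (a *: f) = `|a| * nfs_norm f};
  nfs_norm0_eq0 : {in nfs_set, forall f, nfs_norm f = 0 -> f = 0} }.

Section nfs_type.
Context d (T : measurableType d) (R : realType).
Variables (mu : {measure set T -> \bar R}) (X : normed_fun_space mu).

HB.instance Definition _ :=
  GRing.isSubmodClosed.Build R _ (nfs_set X) (nfs_submod_closed X).

Record nfs_type := NfsType {
  nfs_val :> {mfun_ mu, T >-> R};
  nfs_valP : nfs_val \in nfs_set X }.

HB.instance Definition _ := [isSub for nfs_val].
HB.instance Definition _ := [Choice of nfs_type by <:].
HB.instance Definition _ := [SubChoice_isSubLmodule of nfs_type by <:].

Definition nfs_type_norm (f : nfs_type) : R := nfs_norm X (val f).

Lemma nfs_type_ler_normD f g :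
  nfs_type_norm (f + g) <= nfs_type_norm f + nfs_type_norm g.
Proof. by rewrite /nfs_type_norm raddfD nfs_ler_normD//; exact: nfs_valP. Qed.

Lemma nfs_type_normZ a f : nfs_type_norm (a *: f) = `|a| * nfs_type_norm f.
Proof. by rewrite /nfs_type_norm linearZ nfs_normZ//; exact: nfs_valP. Qed.

Lemma nfs_type_norm0_eq0 f : nfs_type_norm f = 0 -> f = 0.
Proof.
move=> /nfs_norm0_eq0 f0.
by apply: val_inj; rewrite f0 ?raddf0 ?nfs_valP.
Qed.

HB.instance Definition _ :=
  Lmodule_isNormed.Build R nfs_type
  nfs_type_ler_normD nfs_type_normZ nfs_type_norm0_eq0.

End nfs_type.

Section wasq.
Context {R : realType} {X : normedModType R}.

Definition weakly_null (y : nat -> X) :=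
  forall phi : {linear X -> R^o}, continuous phi ->
    phi (y n) @[n --> \oo] --> (0 : R^o).

End wasq.

Definition wasq (R : realType) (X : normedModType R) :=
  forall x : X, `|x| = 1 -> exists y : nat -> X,
    [/\ weakly_null y,
        forall n, `|y n| <= 1,
        `|x + y n| @[n --> \oo] --> (1 : R),
        `|x - y n| @[n --> \oo] --> (1 : R) &
        `|y n| @[n --> \oo] --> (1 : R)].

Record banach_fun_space d (T : measurableType d) (R : realType)
    (mu : {finite_measure set T -> \bar R}) := BanachFunSpace {
  bfs_nfs :> normed_fun_space mu;
  bfs_complete : forall F : set_system (nfs_type bfs_nfs),
    ProperFilter F -> cauchy F -> cvg F;
  bfs_L1 : forall f, f \in nfs_set bfs_nfs -> in_L1 f;
  bfs_ideal : forall f g : {mfun_ mu, T >-> R}, g \in nfs_set bfs_nfs ->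
    (\forall x \ae mu, `|f x| <= `|g x|) ->
    f \in nfs_set bfs_nfs /\ nfs_norm bfs_nfs f <= nfs_norm bfs_nfs g;
  bfs_indic : forall (A : set T) (mA : measurable A),
    L0_indic mu mA \in nfs_set bfs_nfs }.

Section lattice_properties.
Context d (T : measurableType d) (R : realType).
Variables (mu : {measure set T -> \bar R}) (X : normed_fun_space mu).
Implicit Types (f g h : nfs_type X) (D : set (nfs_type X)).

Definition downward_directed D := D !=set0 /\
  forall f g, D f -> D g -> exists2 h, D h & L0_le h f /\ L0_le h g.

Definition is_infimum D f := (forall g, D g -> L0_le f g) /\
  forall h, (forall g, D g -> L0_le h g) -> L0_le h f.

(* A downward directed set is regarded as a decreasing net indexed by itself. *)
Definition order_continuous :=
  forall D, downward_directed D -> is_infimum D 0 ->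
    forall e : R, 0 < e ->
      exists2 f, D f & forall g, D g -> L0_le g f -> `|g| < e.

Definition distribution_function (f : {mfun_ mu, T >-> R}) (s : R) : \bar R :=
  mu [set x | s < `|f x|].

Definition rearrangement_invariant :=
  forall f g : {mfun_ mu, T >-> R}, g \in nfs_set X ->
    (forall s : R, 0 <= s ->
      distribution_function f s = distribution_function g s) ->
    f \in nfs_set X /\ nfs_norm X f = nfs_norm X g.

End lattice_properties.

Section lebesgue01.
Variable R : realType.

(* The real line with the Lebesgue sigma-algebra (not the Borel one). *)
Definition lebesgueTypeR :=
  [the measurableType _ of caratheodory_type (@wlength R idfun)^*%mu].

Lemma measurable_borel_lebesgue (A : set R) :
  measurable A -> measurable (A : set lebesgueTypeR).
Proof. exact: sub_caratheodory. Qed.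

Definition I01 : set lebesgueTypeR := `[0, 1]%classic : set R.

Lemma mI01 : measurable I01.
Proof. by apply: measurable_borel_lebesgue; exact: measurable_itv. Qed.

Lemma I01_fin : (@completed_lebesgue_measure R I01 < +oo)%E.
Proof.
have -> : @completed_lebesgue_measure R I01 =
  lebesgue_measure (`[0, 1]%classic : set R) by [].
by rewrite lebesgue_measure_itv/= lte01 oppr0 addr0 ltry.
Qed.

(* Lebesgue measure on [0, 1], as a measure on the line vanishing off [0, 1]:
   modulo a.e. equality, functions on the line are then functions on [0, 1]. *)
Definition lebesgue01 : {finite_measure set lebesgueTypeR -> \bar R} :=
  mfrestr mI01 I01_fin.

End lebesgue01.

Section cesaro.
Variable R : realType.
Local Notation LR := (lebesgueTypeR R).
Local Notation mu := (@lebesgue01 R).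
Local Notation L0 := {mfun_ mu, LR >-> R}.

Definition seg (x : R) : set LR := `[0, x]%classic.

Definition cesaro_fun (f : LR -> R) (x : LR) : R :=
  (x : R)^-1 * \int[mu]_(t in seg x) f t.

Lemma measurable_seg (x : R) : measurable (seg x).
Proof. by apply: measurable_borel_lebesgue; exact: measurable_itv. Qed.
#[local] Hint Resolve measurable_seg : core.

Lemma le_seg (x y : R) : x <= y -> seg x `<=` seg y.
Proof. by move=> xy; apply: subset_itvl; rewrite bnd_simp. Qed.

Lemma measurable_lebesgue_id : measurable_fun [set: LR] (fun x : LR => x : R).
Proof. by move=> _ A mA; rewrite setTI; exact: measurable_borel_lebesgue. Qed.

Lemma measurable_invr : measurable_fun [set: R] (fun x : R => x^-1).
Proof.
rewrite -(setvU [set 0 : R]); apply/measurable_funU.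
- exact: measurableC.
- exact: measurable_set1.
split; last exact: measurable_fun_set1.
apply: open_continuous_measurable_fun.
  by apply/closed_openC/accessible_closed_set1/hausdorff_accessible;
    exact: norm_hausdorff.
by move=> x /set_mem /= /eqP x0; exact: inv_continuous.
Qed.

Lemma measurable_primitive (h : LR -> \bar R) :
  measurable_fun [set: LR] h -> (forall x, 0 <= h x)%E ->
  measurable_fun [set: LR] (fun x : LR => \int[mu]_(t in seg x) h t)%E.
Proof.
move=> mh h0.
apply: (measurability _ (ErealGenOInfty.measurableE R)) => _ [_ [r ->] <-].
rewrite setTI; apply: measurable_borel_lebesgue; apply: is_interval_measurable.
move=> x y /= xr yr z /andP[xz zy]; rewrite !in_itv/= !andbT in xr yr *.
apply: (lt_le_trans xr); apply: ge0_subset_integral => //.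
- exact: measurable_funS mh.
- exact: le_seg.
Qed.

Lemma measurable_cesaro (f : {mfun LR >-> R}) :
  measurable_fun [set: LR] (cesaro_fun f).
Proof.
apply: measurable_funM.
  exact: (measurableT_comp measurable_invr measurable_lebesgue_id).
have mf : measurable_fun [set: LR] (EFin \o f) by exact/measurable_EFinP.
rewrite (_ : (fun x => _) = fine \o (fun x : LR =>
  (\int[mu]_(t in seg x) ((EFin \o f)^\+ t))
  - (\int[mu]_(t in seg x) ((EFin \o f)^\- t)))%E); last first.
  by apply/funext => x; rewrite /= /Rintegral integralE.
apply: measurableT_comp; first exact: fine_measurable.
apply: emeasurable_funB.
- by apply: measurable_primitive => //; exact: measurable_funepos.
- by apply: measurable_primitive => //; exact: measurable_funeneg.
Qed.

HB.instance Definition _ (f : {mfun LR >-> R}) :=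
  isMeasurableFun.Build _ _ _ _ (cesaro_fun f) (measurable_cesaro f).

Definition cesaro_op (f : L0) : L0 := L0_pi mu (cesaro_fun (repr f)).


Lemma in_L1_seg (f : LR -> R) x : mu.-integrable [set: LR] (EFin \o f) ->
  mu.-integrable (seg x) (EFin \o f).
Proof. exact: integrableS. Qed.

Lemma eq_cesaro_fun (f g : {mfun LR >-> R}) :
  (\forall x \ae mu, f x = g x) -> cesaro_fun f =1 cesaro_fun g.
Proof.
move=> fg x; rewrite /cesaro_fun /Rintegral; congr (_ * fine _).
apply: ae_eq_integral => //.
- by apply: measurable_funTS; exact/measurable_EFinP.
- by apply: measurable_funTS; exact/measurable_EFinP.
- by apply: filterS fg => y /= ->.
Qed.

Lemma cesaro_absE (f : L0) :
  \forall x \ae mu, cesaro_op (L0_abs f) x = cesaro_fun (Num.norm \o f) x.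
Proof.
apply: filterS (L0_piE mu (cesaro_fun (repr (L0_abs f)))) => x ->.
by apply: (@eq_cesaro_fun _ (Num.norm \o repr f)); exact: L0_absE.
Qed.

Lemma cesaro_fun_ge0 (f : LR -> R) x : (forall t, 0 <= f t) ->
  0 <= cesaro_fun f x.
Proof.
move=> f0; have [x0|x0] := leP 0 x.
  by rewrite mulr_ge0 ?invr_ge0// Rintegral_ge0.
rewrite /cesaro_fun (_ : seg x = set0) ?Rintegral_set0 ?mulr0//.
by rewrite /seg set_itv_ge// bnd_simp -ltNge.
Qed.

Lemma in_L1_abs (f : L0) : in_L1 f ->
  mu.-integrable [set: LR] (EFin \o (Num.norm \o f)).
Proof. exact: integrable_norm. Qed.

Lemma cesaro_fun_lin (f g : LR -> R) a x :
  mu.-integrable [set: LR] (EFin \o f) ->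
  mu.-integrable [set: LR] (EFin \o g) ->
  cesaro_fun (fun t => a * f t + g t) x = a * cesaro_fun f x + cesaro_fun g x.
Proof.
move=> /(@in_L1_seg _ x) intf /(@in_L1_seg _ x) intg; rewrite /cesaro_fun.
rewrite RintegralD//.
  by rewrite RintegralZl// mulrDr mulrCA.
rewrite (_ : _ \o _ = fun t => (a%:E * (EFin \o f) t)%E); last by [].
exact: integrableZl.
Qed.

Lemma cesaro_funZ (f : LR -> R) a x :
  mu.-integrable [set: LR] (EFin \o f) ->
  cesaro_fun (fun t => a * f t) x = a * cesaro_fun f x.
Proof.
by move=> /(@in_L1_seg _ x) intf; rewrite /cesaro_fun RintegralZl// mulrCA.
Qed.

Lemma le_cesaro_fun (f g : LR -> R) x :
  mu.-integrable [set: LR] (EFin \o f) ->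
  mu.-integrable [set: LR] (EFin \o g) ->
  (forall t, f t <= g t) -> cesaro_fun f x <= cesaro_fun g x.
Proof.
move=> /(@in_L1_seg _ x) intf /(@in_L1_seg _ x) intg fg.
have [x0|x0] := leP 0 x.
  by rewrite ler_wpM2l ?invr_ge0// le_Rintegral.
rewrite /cesaro_fun (_ : seg x = set0) ?Rintegral_set0 ?mulr0//.
by rewrite /seg set_itv_ge// bnd_simp -ltNge.
Qed.

End cesaro.

Section cesaro_space.
Variable R : realType.
Local Notation LR := (lebesgueTypeR R).
Local Notation mu := (@lebesgue01 R).
Local Notation L0 := {mfun_ mu, LR >-> R}.

Lemma lebesgue01_itv (a b : R) (l r : bool) : 0 <= a -> b <= 1 -> a <= b ->
  mu ([set` Interval (BSide l a) (BSide r b)] : set R) = (b - a)%:E.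
Proof.
move=> a0 b1 ab.
have -> : mu ([set` Interval (BSide l a) (BSide r b)] : set R) =
  lebesgue_measure ([set` Interval (BSide l a) (BSide r b)] `&` `[0, 1] : set R).
  by [].
rewrite setIidl; last first.
  by apply: subset_itvScc; rewrite bnd_simp.
rewrite lebesgue_measure_itv/= lte_fin; case: ltP => [//|ba].
by rewrite (@le_anti _ _ a b) ?subrr// ab.
Qed.

Lemma lebesgue01_off : mu.-negligible (~` (`[0, 1[%classic : set R)).
Proof.
apply/negligibleP.
  by apply: measurable_borel_lebesgue; exact: measurableC.
suff : lebesgue_measure ((~` `[0, 1[) `&` `[0, 1] : set R) = 0%E by [].
rewrite (_ : _ `&` _ = [set 1]) ?lebesgue_measure_set1//.
apply/seteqP; split => x /=; rewrite !in_itv/=.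
  move=> [/negP + /andP[x0 x1]]; rewrite x0/= -leNgt => x1'.
  by apply/eqP; rewrite eq_le x1.
by move=> ->; rewrite ler01 lexx ltxx andbF; split.
Qed.

Lemma cesaro_abs_eq0 (f : L0) : in_L1 f -> cesaro_op (L0_abs f) = 0 -> f = 0.
Proof.
move=> L1f /L0P Cf0.
have {}Cf0 : \forall x \ae mu, cesaro_fun (Num.norm \o f) x = 0.
  move: Cf0 (cesaro_absE f) (L00E mu).
  by apply: filterS3 => x -> -> ->.
have f0 n : mu.-negligible
    ((`[0, 1 - n.+1%:R^-1]%classic : set R) `&` [set t : LR | f t != 0]).
  have n0 : 0 < n.+1%:R^-1 :> R by rewrite invr_gt0.
  have n1 : n.+1%:R^-1 <= 1 :> R by rewrite invf_le1// ler1n.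
  have [x /andP[nx x1] Cx] : exists2 x : R, 1 - n.+1%:R^-1 < x < 1 &
      cesaro_fun (Num.norm \o f) x = 0.
    apply/not_exists2P => noX.
    suff : mu (`]1 - n.+1%:R^-1, 1[%classic : set R) = 0%E.
      rewrite lebesgue01_itv ?subr_ge0 ?gerBl ?(ltW n0)//.
      by rewrite opprB addrC subrK => -[] /eqP; rewrite gt_eqF.
    apply: measure_negligible.
      by apply: measurable_borel_lebesgue; exact: measurable_itv.
    by apply: negligibleS Cf0 => x /=; rewrite in_itv/= => xn Cx; case: (noX x).
  have x0 : 0 < x by rewrite (le_lt_trans _ nx)// subr_ge0.
  pose S : set LR := `[0, x]%classic.
  have mS : measurable S.
    by apply: measurable_borel_lebesgue; exact: measurable_itv.
  have intx : mu.-integrable S (EFin \o f).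
    exact: integrableS L1f.
  have /(ae_eq_integral_abs mu mS) :
      (\int[mu]_(t in S) `|(EFin \o f) t| = 0)%E.
    move/eqP : Cx; rewrite mulf_eq0 invr_eq0 gt_eqF//= => /eqP Cx.
    apply: (eq_trans (esym (fineK _))); last by congr EFin; exact: Cx.
    exact: integrable_fin_num (integrable_norm intx).
  move=> /(_ (measurable_int _ intx)); apply: negligibleS => t/= [t0 ft0].
  move=> ft; move/eqP: ft0; apply; apply: EFin_inj; apply: ft.
  move: t0; rewrite !in_itv/= => /andP[t0 tn].
  by apply/andP; split; [exact: t0|exact: le_trans tn (ltW nx)].
apply/L0P.
suff : \forall x \ae mu, f x = 0 by move: (L00E mu); apply: filterS2 => x -> ->.
have := negligibleU lebesgue01_off (negligible_bigcup f0).
apply: negligibleS => t /= /eqP ft.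
have [t01|t01] := boolP ((t : R) \in `[0, 1[); last by left; exact/negP.
right; move: t01; rewrite in_itv/= => /andP[t0 t1].
have t1' : 0 < 1 - (t : R) by rewrite subr_gt0.
have [n _ /(_ n (leqnn n)) /= nt] := near_infty_natSinv_lt (PosNum t1').
exists n => //; split => //=; rewrite in_itv/=; apply/andP; split => //.
by rewrite lerBrDr -lerBrDl; exact: ltW.
Qed.

Variable E : banach_fun_space mu.

(* Only a normed space: with the requirement f \in L_1 the norm need not be
   complete (for E = L_1 it is that of L_1(log(1/t) dt), a space containing
   functions that are not integrable near 1). *)
Definition cesaro_pred : {pred L0} :=
  fun f => `[< in_L1 f /\ cesaro_op (L0_abs f) \in nfs_set E >].

Definition cesaro_norm (f : L0) : R := nfs_norm E (cesaro_op (L0_abs f)).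

Lemma cesaro_predP f :
  reflect (in_L1 f /\ cesaro_op (L0_abs f) \in nfs_set E) (f \in cesaro_pred).
Proof. exact: asboolP. Qed.

Lemma L0_linE a (f g : L0) : a *: f + g = L0_pi mu (a *: repr f + repr g).
Proof.
apply/L0P; near=> t.
have -> : (a *: f + g : L0) t = (a *: f : L0) t + g t.
  by near: t; exact: L0DE.
have -> : (a *: f : L0) t = a * f t by near: t; exact: L0ZE.
by apply: esym; near: t; exact: L0_piE.
Unshelve. all: by end_near. Qed.

Lemma in_L1_lin a (f g : L0) : in_L1 f -> in_L1 g -> in_L1 (a *: f + g).
Proof.
move=> L1f L1g; rewrite L0_linE; apply: in_L1_pi.
rewrite (_ : _ \o _ = ((fun t => a%:E * (EFin \o f) t) \+ (EFin \o g))%E).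
  by apply: integrableD => //; exact: integrableZl.
exact/funext.
Qed.

Lemma cesaro_abs_lin a (f g : L0) : in_L1 f -> in_L1 g ->
  \forall x \ae mu, `|cesaro_op (L0_abs (a *: f + g)) x| <=
    `|(`|a| *: cesaro_op (L0_abs f) + cesaro_op (L0_abs g) : L0) x|.
Proof.
move=> L1f L1g; near=> x.
have -> : (`|a| *: cesaro_op (L0_abs f) + cesaro_op (L0_abs g) : L0) x =
    (`|a| *: cesaro_op (L0_abs f) : L0) x + cesaro_op (L0_abs g) x.
  by near: x; exact: L0DE.
have -> : (`|a| *: cesaro_op (L0_abs f) : L0) x =
    `|a| * cesaro_op (L0_abs f) x by near: x; exact: L0ZE.
have -> : cesaro_op (L0_abs f) x = cesaro_fun (Num.norm \o f) x.
  by near: x; exact: cesaro_absE.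
have -> : cesaro_op (L0_abs g) x = cesaro_fun (Num.norm \o g) x.
  by near: x; exact: cesaro_absE.
have -> : cesaro_op (L0_abs (a *: f + g)) x =
    cesaro_fun (Num.norm \o (a *: f + g : L0)) x.
  by near: x; exact: cesaro_absE.
rewrite ger0_norm; last by apply: cesaro_fun_ge0 => t /=.
apply: le_trans (ler_norm _).
have nf := in_L1_abs L1f; have ng := in_L1_abs L1g.
rewrite -cesaro_fun_lin// (@eq_cesaro_fun _ (Num.norm \o repr (a *: f + g))
  (Num.norm \o (a *: repr f + repr g))); last first.
  rewrite L0_linE; apply: filterS (L0_piE mu (a *: repr f + repr g)) => t Et.
  by congr Num.norm; exact: Et.
apply: le_cesaro_fun => [||t /=].
- apply: integrable_norm.
  rewrite (_ : _ \o _ = ((fun t => a%:E * (EFin \o f) t) \+ (EFin \o g))%E).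
    by apply: integrableD => //; exact: integrableZl.
  exact/funext.
- rewrite (_ : _ \o _ = ((fun t => `|a|%:E * (EFin \o (Num.norm \o f)) t)
      \+ (EFin \o (Num.norm \o g)))%E); last exact/funext.
  by apply: integrableD => //; exact: integrableZl.
- by rewrite -normrM ler_normD.
Unshelve. all: by end_near. Qed.

Lemma cesaro_submod_closed : submod_closed cesaro_pred.
Proof.
split.
  have L10 : in_L1 (0 : L0) by apply: in_L1_pi; exact: integrable0.
  apply/cesaro_predP; split => //; rewrite (_ : cesaro_op _ = 0) ?rpred0//.
  apply/L0P; move: (L00E mu) (cesaro_absE (0 : L0)); apply: filterS2 => x -> ->.
  rewrite (@eq_cesaro_fun _ (Num.norm \o repr (0 : L0)) (cst 0)).
    by rewrite /cesaro_fun /Rintegral integral0 mulr0.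
  apply: filterS (L00E mu) => t t0.
  by apply: (etrans _ (normr0 _)); congr Num.norm; exact: t0.
move=> a f g /cesaro_predP[L1f Cf] /cesaro_predP[L1g Cg]; apply/cesaro_predP.
split; first exact: in_L1_lin.
apply: (bfs_ideal _ (cesaro_abs_lin a L1f L1g)).1.
by rewrite rpredD// rpredZ.
Qed.

Lemma cesaro_ler_normD : {in cesaro_pred &, forall f g,
  cesaro_norm (f + g) <= cesaro_norm f + cesaro_norm g}.
Proof.
move=> f g /cesaro_predP[L1f Cf] /cesaro_predP[L1g Cg].
have := cesaro_abs_lin 1 L1f L1g; rewrite normr1 !scale1r => le.
apply: le_trans (bfs_ideal _ le).2 _; first by rewrite rpredD.
exact: nfs_ler_normD.
Qed.

Lemma cesaro_normZ a : {in cesaro_pred, forall f,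
  cesaro_norm (a *: f) = `|a| * cesaro_norm f}.
Proof.
move=> f /cesaro_predP[L1f Cf]; rewrite /cesaro_norm.
rewrite (_ : cesaro_op _ = `|a| *: cesaro_op (L0_abs f)) ?nfs_normZ ?normr_id//.
apply/L0P; near=> x.
have -> : cesaro_op (L0_abs (a *: f)) x =
    cesaro_fun (Num.norm \o (a *: f : L0)) x by near: x; exact: cesaro_absE.
have -> : (`|a| *: cesaro_op (L0_abs f) : L0) x =
    `|a| * cesaro_op (L0_abs f) x by near: x; exact: L0ZE.
have -> : cesaro_op (L0_abs f) x = cesaro_fun (Num.norm \o f) x.
  by near: x; exact: cesaro_absE.
rewrite (@eq_cesaro_fun _ (Num.norm \o repr (a *: f))
  (`|a| *: (Num.norm \o repr f : {mfun LR >-> R}))); last first.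
  apply: filterS (L0ZE a f) => t Et.
  by apply: (etrans _ (normrM _ _)); congr Num.norm; exact: Et.
by rewrite -cesaro_funZ//; exact: in_L1_abs.
Unshelve. all: by end_near. Qed.

Lemma cesaro_norm0 : {in cesaro_pred, forall f, cesaro_norm f = 0 -> f = 0}.
Proof.
move=> f /cesaro_predP[L1f Cf] /nfs_norm0_eq0 Cf0.
by apply: cesaro_abs_eq0 => //; exact: Cf0.
Qed.

Definition cesaro_space : normed_fun_space mu :=
  NormedFunSpace cesaro_submod_closed cesaro_ler_normD cesaro_normZ cesaro_norm0.

End cesaro_space.

(* Main.v *)
(* For x in the unit sphere take y_n = x r_n, with r_n the Rademacher functions.
   Then |y_n| = |x|, so ||y_n|| = 1, and |x +- y_n| = |x| (1 +- r_n), whose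
   Cesaro transform is C|x| +- C(|x| r_n). The last term is dominated by C|x|
   and tends to 0 pointwise, hence in norm, by dominated convergence in the
   order continuous space E.

   Both this pointwise limit and the weak nullity of (y_n) say that L(r_n) -> 0
   for a linear L on bounded functions with L(h_k) -> 0 whenever |h_k| <= 1 and
   h_k -> 0 a.e. If |L(r_n)| >= e for infinitely many n, averaging such r_n with
   the signs of L(r_n) gives h_K with L(h_K) >= e and, by orthogonality,
   ||h_K||_2^2 = 1/K; along K = 2^k these tend to 0 a.e., a contradiction. *)
Require Import Defs.
From HB Require Import structures.
From mathcomp Require Import all_boot all_order all_algebra.
From mathcomp Require Import all_classical all_reals all_analysis.
From mathcomp Require Import measurable_realfun.

Set Implicit Arguments.
Unset Strict Implicit.
Unset Printing Implicit Defensive.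

Import Order.TTheory GRing.Theory Num.Theory.
Import numFieldNormedType.Exports.

Local Open Scope classical_set_scope.
Local Open Scope ring_scope.

(** * Rademacher functions and their orthogonality *)

Section rademacher.
Variable R : realType.
Local Notation LR := (lebesgueTypeR R).
Local Notation mu := (@lebesgue01 R).

(** By monotonicity each fibre is an interval, and a preimage is a countable union of fibres. *)
Lemma measurable_truncn : measurable_fun [set: R] (@Num.truncn R).
Proof.
move=> _ A _; rewrite setTI.
rewrite (_ : _ @^-1` A = \bigcup_(k in A) (@Num.truncn R @^-1` [set k])).
  apply: bigcup_measurable => k _; apply: is_interval_measurable.
  move=> x y /= xk yk z /andP[xz zy]; apply/eqP.
  have := le_truncn zy; have := le_truncn xz; rewrite xk yk => kz zk.
  by rewrite eqn_leq zk kz.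
by apply/seteqP; split => [x Ax|x [k Ak /= ->]//]; exists (Num.truncn x).
Qed.

(** For [t] in [[0, 1[], the index of the cell [[k / N, (k + 1) / N[] containing [t]; for [t < 0]
    truncation gives 0. *)
Definition digit (N : nat) (t : LR) : nat := Num.truncn (N%:R * (t : R)).

Lemma measurable_comp_digit N (g : nat -> R) :
  measurable_fun [set: LR] (g \o digit N).
Proof.
apply: (@measurableT_comp _ _ _ _ _ _ g) => //.
apply: (measurableT_comp measurable_truncn).
by apply: measurable_funM => //; exact: measurable_lebesgue_id.
Qed.

(** Almost everywhere the integrand is a step function, constant on [N] cells of measure [1 / N]. *)
Lemma integral_comp_digit N (g : nat -> R) : (0 < N)%N ->
  (\int[mu]_t (g (digit N t))%:E = (N%:R^-1 * \sum_(k < N) g k)%:E)%E.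
Proof.
move=> N0; have N0' : 0 < N%:R :> R by rewrite ltr0n.
pose I (k : nat) : set LR := `[k%:R / N%:R, k.+1%:R / N%:R[%classic : set R.
have mI k : measurable (I k).
  by apply: measurable_borel_lebesgue; exact: measurable_itv.
have muI (k : 'I_N) : mu (I k) = (N%:R^-1)%:E.
  rewrite lebesgue01_itv ?divr_ge0//.
  - by rewrite -mulrBl -natrB// subSnn mul1r.
  - by rewrite ler_pdivrMr// mul1r ler_nat.
  - by rewrite ler_pM2r ?invr_gt0// ler_nat.
have intI (k : 'I_N) : (\int[mu]_t (\1_(I k) t)%:E = (N%:R^-1)%:E)%E.
  by rewrite integral_indic// setIT; exact: muI.
have II k t : 0 <= (t : R) -> (t \in I k) = (digit N t == k).
  move=> t0; have Nt0 : 0 <= N%:R * (t : R) by rewrite mulr_ge0.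
  rewrite truncn_eq// mem_setE in_itv/= ler_pdivrMr// ltr_pdivlMr//.
  by rewrite mulrC.
transitivity (\int[mu]_t (\sum_(k < N) ((g k)%:E * (\1_(I k) t)%:E)))%E.
  apply: ae_eq_integral; first exact: measurableT.
  - by apply/measurable_EFinP; exact: measurable_comp_digit.
  - apply: emeasurable_sum => k; apply: measurable_funeM.
    by apply/measurable_EFinP; exact: measurable_indic.
  (* The complement of [[0, 1[] is negligible, and inside it exactly one summand survives. *)
  apply: negligibleS (lebesgue01_off R) => t /= + t01; apply.
  move: t01; rewrite in_itv/= => /andP[t0 t1] _.
  have tN : (digit N t < N)%N.
    rewrite /digit truncn_lt_nat ?mulr_ge0//.
    by rewrite -[ltRHS]mulr1 ltr_pM2l.
  rewrite (bigD1 (Ordinal tN))//= big1 ?adde0.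
    by rewrite indicE II// eqxx mule1.
  move=> k kt; rewrite indicE II// (_ : _ == _ = false) ?mule0//.
  by apply: contraNF kt => /eqP kt; apply/eqP/val_inj.
rewrite integral_sum//.
  under eq_bigr => k _.
    rewrite integralZl//; last exact: integrable_indic.
    rewrite intI -EFinM.
    over.
  by rewrite sumEFin mulr_sumr; under eq_bigr do rewrite mulrC.
by move=> k; apply: integrableZl => //; exact: integrable_indic.
Qed.

(** The sign alternates on dyadic cells of length [2^-n]. Being a function of [digit], it has
    modulus 1 on the whole line, and its integrals reduce to finite sums. *)
Definition rademacher_fun n (t : LR) : R := (-1) ^+ digit (2 ^ n) t.

Lemma measurable_rademacher n : measurable_fun [set: LR] (rademacher_fun n).
Proof. exact: (measurable_comp_digit _ (fun k => (-1) ^+ k)). Qed.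

HB.instance Definition _ n :=
  isMeasurableFun.Build _ _ _ _ (rademacher_fun n) (measurable_rademacher n).

Definition rademacher n : {mfun LR >-> R} := rademacher_fun n.

Lemma normr_rademacher n t : `|rademacher n t| = 1.
Proof. by rewrite /rademacher/= /rademacher_fun normrX normrN1 expr1n. Qed.

Lemma rademacher_sqr n t : rademacher n t * rademacher n t = 1.
Proof. by rewrite -expr2 -real_normK ?num_real// normr_rademacher expr1n. Qed.

(** Dividing by [2 ^ d] forgets the last [d] binary digits; this expresses Rademacher functions of
    different orders through one common digit. *)
Lemma digit_div (n d : nat) (t : LR) :
  digit (2 ^ n) t = (digit (2 ^ (n + d)) t %/ 2 ^ d)%N.
Proof.
(* For [t < 0] both sides are 0 by the convention of truncation. *)
have [t0|t0] := leP 0 (t : R); last first.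
  have neg (N : nat) : digit N t = 0.
    by apply/truncn0Pn; rewrite -ltNge (le_lt_trans _ ltr01)// nmulr_lle0.
  by rewrite !neg div0n.
have Nt0 (N : nat) : 0 <= N%:R * (t : R) by rewrite mulr_ge0.
have d0 : 0 < (2 ^ d)%:R :> R by rewrite ltr0n expn_gt0.
apply/eqP; rewrite /digit truncn_eq//.
set k := Num.truncn _; have /andP[k1 k2] := truncn_itv (Nt0 (2 ^ (n + d))%N).
rewrite -/k expnD natrM mulrAC in k1 k2.
apply/andP; split; rewrite -(ler_pM2r d0, ltr_pM2r d0) -natrM.
  by apply: le_trans k1; rewrite ler_nat leq_divM.
by apply: (lt_le_trans k2); rewrite ler_nat ltn_ceil// expn_gt0.
Qed.

Lemma sum_ord_double (V : nmodType) (g : nat -> V) N :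
  \sum_(k < 2 * N) g k = \sum_(k < N) (g (2 * k)%N + g (2 * k).+1).
Proof.
elim: N => [|N ih]; first by rewrite muln0 !big_ord0.
by rewrite mulnS 2!big_ord_recr/= ih big_ord_recr/= addrA.
Qed.

(** Both factors are functions of the finer digit. The digits [2k] and [2k + 1] lie in the same
    coarse cell but have opposite parity, so their contributions cancel. *)
Lemma integral_rademacherM n m : (n < m)%N ->
  (\int[mu]_t (rademacher n t * rademacher m t)%:E = 0)%E.
Proof.
move=> nm; rewrite -(subnKC nm) addSnnS; move: (m - n.+1)%N => d.
pose g k : R := (-1) ^+ (k %/ 2 ^ d.+1) * (-1) ^+ k.
under eq_integral => t _.
  rewrite (_ : _ * _ = g (digit (2 ^ (n + d.+1)) t)); first over.
  by rewrite /rademacher/= /rademacher_fun (digit_div n d.+1).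
rewrite integral_comp_digit ?expn_gt0// addnS expnS sum_ord_double.
rewrite big1 ?mulr0//.
move=> k _; rewrite /g !expnS 2!divnMA mulKn// -[(2 * k).+1]addn1 mulnC.
rewrite divnMDl// (@divn_small 1 2)// addn0 addn1 exprS mulN1r mulrN.
by rewrite subrr.
Qed.

End rademacher.

(** * Almost everywhere convergence from summable second moments *)

Section summable_squares.
Context d (T : measurableType d) (R : realType).
Variable mu : {measure set T -> \bar R}.

(** The series of squares has finite integral, hence converges a.e., and its terms tend to 0. *)
Lemma ae_cvg0_summable_sqr (h : nat -> {mfun T >-> R}) :
  (forall j, \int[mu]_t (h j t ^+ 2)%:E <= (1 / (2 ^ j.+1)%:R)%:E)%E ->
  \forall t \ae mu, h j t @[j --> \oo] --> (0 : R).
Proof.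
move=> hj.
have mh j : measurable_fun [set: T] (fun t => (h j t ^+ 2)%:E).
  by apply/measurable_EFinP; exact: measurable_funX.
have h0 j t : (0 <= (h j t ^+ 2)%:E)%E by rewrite lee_fin sqr_ge0.
pose F t : \bar R := (\sum_(j <oo) (h j t ^+ 2)%:E)%E.
have F0 t : (0 <= F t)%E by apply: nneseries_ge0 => j _ _; exact: h0.
have intF : mu.-integrable [set: T] F.
  apply/integrableP; split.
    by apply: ge0_emeasurable_sum => // j t _ _; exact: h0.
  under eq_integral do rewrite gee0_abs//.
  rewrite integral_nneseries//.
  apply: (@le_lt_trans _ _ 1%:E); last exact: ltry.
  (* The weights [1 / 2^(j+1)] add up to at most 1. *)
  apply: le_trans (epsilon_trick0 xpredT ler01).
  apply: lee_nneseries => [j _ _|j _]; last exact: hj.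
  by apply: integral_ge0 => t _; exact: h0.
apply: filterS (integrable_ae measurableT intF) => t /(_ I).
rewrite ge0_fin_numE// => Ft.
have /(_ Ft) tail0 := @nneseries_tail_cvg _ (fun j => (h j t ^+ 2)%:E) xpredT.
have sqr0 : (h j t ^+ 2)%:E @[j --> \oo] --> (0 : \bar R).
  (* Each square is bounded by the tail of the series starting at its own index. *)
  apply: (@squeeze_cvge _ _ _ _ (cst 0%E) _
    (fun N => \sum_(N <= j <oo) (h j t ^+ 2)%:E)%E).
  - apply: nearW => j; rewrite h0/=.
    apply: le_trans (nneseries_lim_ge j.+1 _) => //.
    by rewrite big_nat1.
  - exact: cvg_cst.
  - by apply: tail0 => j _; exact: h0.
move/fine_cvgP : sqr0 => [_ /=] sqr0.
apply/norm_cvg0P.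
have : Num.sqrt (h j t ^+ 2) @[j --> \oo] --> Num.sqrt (0 : R).
  by apply: continuous_cvg => //; exact: sqrt_continuous.
by rewrite sqrtr0; under eq_fun do rewrite sqrtr_sqr.
Qed.

End summable_squares.

(** * Signed averages of Rademacher functions *)

Section averaging.
Variable R : realType.
Local Notation LR := (lebesgueTypeR R).
Local Notation mu := (@lebesgue01 R).
Local Notation r := (@rademacher R).

Definition bounded_mfun (f : {mfun LR >-> R}) :=
  exists M : R, forall t, `|f t| <= M.

Lemma mfun_linE (a : R) (f g : {mfun LR >-> R}) t :
  (a *: f + g) t = a * f t + g t.
Proof. by []. Qed.

Lemma bounded_mfun_lin a f g : bounded_mfun f -> bounded_mfun g ->
  bounded_mfun (a *: f + g).
Proof.
move=> [M fM] [N gN]; exists (`|a| * M + N) => t; rewrite mfun_linE.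
apply: le_trans (ler_normD _ _) _; apply: lerD; last exact: gN.
by rewrite normrM ler_wpM2l.
Qed.

Lemma bounded_rademacher n : bounded_mfun (r n).
Proof. by exists 1 => t; rewrite normr_rademacher. Qed.

Lemma lebesgue01T : mu [set: LR] = 1%E.
Proof.
have : mu ([set: R]) = lebesgue_measure ([set: R] `&` `[0, 1]%classic) by [].
by rewrite setTI lebesgue_measure_itv/= lte01 oppr0 adde0.
Qed.

Lemma integral_lebesgue01_1 : (\int[mu]_t (1 : R)%:E = 1)%E.
Proof. by rewrite integral_cst// mul1e; exact: lebesgue01T. Qed.

Lemma integral_rademacher2 n m :
  (\int[mu]_t (r n t * r m t)%:E = (n == m)%:R%:E)%E.
Proof.
have [->|] := eqVneq n m.
  under eq_integral do rewrite rademacher_sqr.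
  exact: integral_lebesgue01_1.
rewrite neq_ltn => /orP[nm|mn]; first exact: integral_rademacherM.
by under eq_integral do rewrite mulrC; exact: integral_rademacherM.
Qed.

(** The recursion has the shape [a *: f + g], so that linearity of a functional applies by induction
    on [K]. *)
Fixpoint rademacher_sum (s : nat -> R) (nu : nat -> nat) (K : nat) :
    {mfun LR >-> R} :=
  if K is k.+1 then s k *: r (nu k) + rademacher_sum s nu k else 0.

Lemma rademacher_sumE s nu K t :
  rademacher_sum s nu K t = \sum_(k < K) s k * r (nu k) t.
Proof.
elim: K => [|K ih]; first by rewrite big_ord0.
by rewrite big_ord_recr/= addrC -ih.
Qed.

Lemma bounded_rademacher_sum s nu K : bounded_mfun (rademacher_sum s nu K).
Proof.
elim: K => [|K ih]; last exact: bounded_mfun_lin (bounded_rademacher _) ih.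
by exists 0 => t; rewrite normr0.
Qed.

(** In the expanded double sum orthogonality leaves the diagonal, where each of the [K] terms is
    [s k ^ 2 = 1]; injectivity of [nu] keeps the other terms off it. *)
Lemma integral_rademacher_sum_sqr s nu K : 
  injective nu -> (forall k, `|s k| = 1) ->
  (\int[mu]_t (rademacher_sum s nu K t ^+ 2)%:E = K%:R%:E)%E.
Proof.
move=> nuI s1.
have intr n m a : mu.-integrable [set: LR] (fun t => (a * (r n t * r m t))%:E).
  apply: measurable_bounded_integrable.
  - exact: measurableT.
  - exact: fin_num_fun_lty.
  - apply: measurable_funM; first exact: measurable_cst.
    by apply: measurable_funM; exact: measurable_rademacher.
  - exists `|a|; split => // M aM t _ /=.
    by rewrite !normrM !normr_rademacher !mulr1 ltW.
transitivity (\int[mu]_t (\sum_(k < K) \sum_(l < K)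
    (s k * s l * (r (nu k) t * r (nu l) t))%:E))%E.
  apply: eq_integral => t _; rewrite rademacher_sumE expr2 big_distrlr/=.
  rewrite -sumEFin.
  apply: eq_bigr => k _; rewrite -sumEFin; apply: eq_bigr => l _.
  by congr EFin; rewrite mulrACA.
rewrite integral_sum//; last by move=> k; exact: integrable_sum.
rewrite (eq_bigr (fun=> 1%E)).
  by rewrite sumEFin sumr_const card_ord.
move=> k _; rewrite integral_sum// (bigD1 k)//= big1 ?adde0 => [|l lk].
  under eq_integral do
    rewrite rademacher_sqr mulr1 -expr2 -real_normK ?num_real// s1 expr1n.
  exact: integral_lebesgue01_1.
under eq_integral do rewrite EFinM.
rewrite integralZl//; last first.
  by have := intr (nu k) (nu l) 1; under eq_fun do rewrite mul1r.
rewrite integral_rademacher2 (inj_eq nuI) (_ : _ == _ = false) ?mule0//.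
by apply: contraNF lk => /eqP/val_inj ->.
Qed.

(** Stated for an abstract [L] because it serves twice: for the Cesàro mean of [v h] at a fixed
    point, and for [phi] applied to the product of [f] and [h]. *)
Lemma rademacher_cvg0 (L : {mfun LR >-> R} -> R) :
  (forall a f g, bounded_mfun f -> bounded_mfun g ->
    L (a *: f + g) = a * L f + L g) ->
  (forall h : nat -> {mfun LR >-> R}, (forall k t, `|h k t| <= 1) ->
    (\forall t \ae mu, h k t @[k --> \oo] --> (0 : R)) ->
    L (h k) @[k --> \oo] --> (0 : R)) ->
  L (r n) @[n --> \oo] --> (0 : R).
Proof.
move=> Llin Lcvg.
have b0 : bounded_mfun (0 : {mfun LR >-> R}) by exists 0 => t; rewrite normr0.
have L0 : L 0 = 0.
  have := Llin 1 0 0 b0 b0; rewrite scale1r addr0 mul1r => /eqP.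
  by rewrite -subr_eq0 opprD addNKr oppr_eq0 => /eqP.
apply: contrapT => /cvgr0Pnorm_lt/existsNP[e] /not_implyP[e0 Le].
have next N : {n | (N <= n)%N & e <= `|L (r n)|}.
  apply: cid2; apply: contrapT => /forall2NP noN; apply: Le.
  exists N => // n /= Nn; have [//|] := noN n.
  by move=> /negP; rewrite -ltNge.
(* Each index is chosen beyond the previous one, so [nu] is strictly increasing, hence injective. *)
pose nu := fix nu k := if k is k'.+1 then s2val (next (nu k').+1)
                       else s2val (next 0).
have nuS k : (nu k < nu k.+1)%N by exact: (s2valP (next (nu k).+1)).
have Lnu k : e <= `|L (r (nu k))|.
  by case: k => [|k]; [exact: (s2valP' (next 0))|exact: (s2valP' (next _))].
have nuI : injective nu.
  have mono := homo_ltn ltn_trans nuS.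
  move=> i j /eqP; apply: contraTeq; rewrite !neq_ltn.
  by move=> /orP[] /mono ->; rewrite ?orbT.
(* The sign of [L (r (nu k))], taken to be 1 at 0 so that its modulus is always 1. *)
pose s k := if 0 <= L (r (nu k)) then 1 else -1 : R.
have s1 k : `|s k| = 1 by rewrite /s; case: ifP; rewrite ?normrN normr1.
have sL k : s k * L (r (nu k)) = `|L (r (nu k))|.
  by rewrite /s; case: ger0P => _; rewrite ?mul1r ?mulN1r.
have LS K : K%:R * e <= L (rademacher_sum s nu K).
  elim: K => [|K ih]; first by rewrite mul0r L0.
  rewrite [rademacher_sum _ _ _]/= Llin; last exact: bounded_rademacher_sum.
    by rewrite sL -natr1 mulrDl mul1r addrC lerD.
  exact: bounded_rademacher.
(* The summand 0 puts the average in the form to which [Llin] applies. *)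
pose A K : {mfun LR >-> R} := K%:R^-1 *: rademacher_sum s nu K + 0.
have AE K t : A K t = K%:R^-1 * rademacher_sum s nu K t.
  by rewrite mfun_linE addr0.
have LA K : (0 < K)%N -> e <= L (A K).
  move=> K0; rewrite Llin//; last exact: bounded_rademacher_sum.
  by rewrite L0 addr0 ler_pdivlMl ?ltr0n.
have A1 K t : `|A K t| <= 1.
  rewrite AE normrM normfV normr_nat; case: K => [|K].
    by rewrite invr0 mul0r.
  rewrite ler_pdivrMl// mulr1 rademacher_sumE.
  apply: le_trans (ler_norm_sum _ _ _) _.
  rewrite (eq_bigr (fun=> 1)) ?sumr_const ?card_ord//.
  by move=> k _; rewrite normrM s1 normr_rademacher mulr1.
have intA K : (0 < K)%N -> (\int[mu]_t (A K t ^+ 2)%:E = (K%:R^-1)%:E)%E.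
  move=> K0; under eq_integral do rewrite AE exprMn EFinM.
  rewrite ge0_integralZl_EFin.
  - rewrite integral_rademacher_sum_sqr// -EFinM; congr EFin.
    by rewrite expr2 -mulrA mulVf ?mulr1// pnatr_eq0 -lt0n.
  - exact: measurableT.
  - by move=> t _; rewrite lee_fin sqr_ge0.
  - apply/measurable_EFinP; exact: measurable_funX.
  - exact: sqr_ge0.
(* Along [K = 2^(k+1)] the second moment [1 / K] is exactly the summable bound of
   [ae_cvg0_summable_sqr]. *)
have : L (A (2 ^ k.+1)%N) @[k --> \oo] --> (0 : R).
  apply: Lcvg => [k t|]; first exact: A1.
  apply: (@ae_cvg0_summable_sqr _ _ _ mu) => j.
  by rewrite intA ?expn_gt0// div1r.
move=> /cvgr0Pnorm_lt/(_ _ e0)[N _ /(_ N (leqnn N))] /=.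
by rewrite ltNge (le_trans _ (ler_norm _))// LA// expn_gt0.
Qed.

End averaging.

(** * Dominated convergence in an order continuous space *)

Section order_continuity.
Context d (T : measurableType d) (R : realType).
Variables (mu : {finite_measure set T -> \bar R}) (E : banach_fun_space mu).
Local Notation L0 := {mfun_ mu, T >-> R}.

(** The suprema of the tails of [|u n|] decrease to 0 a.e., so order continuity makes their norms
    small, and they dominate [|u n|]. *)
Lemma order_continuous_dct (f : L0) (u : nat -> L0) :
  order_continuous E -> f \in nfs_set E ->
  (forall n, \forall x \ae mu, `|u n x| <= `|f x|) ->
  (\forall x \ae mu, u n x @[n --> \oo] --> (0 : R)) ->
  nfs_norm E (u n) @[n --> \oo] --> (0 : R).
Proof.
move=> ocE fE uf u0.
(* The domination holds only a.e.; cutting at [|f|] makes the sequence bounded at every point, so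
   the tail suprema are real and measurable. *)
pose w n x := Num.min `|u n x| `|f x|.
have mw n : measurable_fun [set: T] (w n).
  by apply: measurable_minr; apply: measurableT_comp.
have w_ub x : has_ubound (range (w ^~ x)).
  by exists `|f x| => _ [n _ <-]; rewrite ge_min lexx orbT.
pose v n x := sups (w ^~ x) n.
have mv n : measurable_fun [set: T] (v n).
  by apply: measurable_fun_sups => // x _; exact: w_ub.
have w_le_v n k x : (n <= k)%N -> w k x <= v n x.
  move=> nk; apply: ub_le_sup; first exact/has_ubound_sdrop/w_ub.
  by exists k.
have v0 n x : 0 <= v n x.
  by apply: le_trans (w_le_v n n x (leqnn n)); rewrite le_min !normr_ge0.
have vf n x : v n x <= `|f x|.
  apply: ge_sup; first by exists (w n x); exists n => /=.
  by move=> _ [k _ <-]; rewrite ge_min lexx orbT.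
pose V n : L0 := L0_pi mu (mfun_Sub (mem_set (mv n) : v n \in mfun)).
have VE n : \forall x \ae mu, V n x = v n x by exact: L0_piE.
have VE' n : V n \in nfs_set E.
  apply: (bfs_ideal fE _).1; apply: filterS (VE n) => x ->.
  by rewrite ger0_norm.
pose g n : nfs_type E := NfsType (VE' n).
have Dg : downward_directed (range g).
  split; first by exists (g 0); exists 0.
  move=> _ _ [m _ <-] [n _ <-].
  exists (g (maxn m n)); first by exists (maxn m n).
  split.
    move: (VE m) (VE (maxn m n)); apply: filterS2 => x /= -> ->.
    by apply: nonincreasing_sups; [exact: w_ub|exact: leq_maxl].
  move: (VE n) (VE (maxn m n)); apply: filterS2 => x /= -> ->.
  by apply: nonincreasing_sups; [exact: w_ub|exact: leq_maxr].
have inf0 : is_infimum (range g) 0.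
  split.
    move=> _ [n _ <-]; move: (L00E mu) (VE n); apply: filterS2 => x /= -> ->.
    exact: v0.
  (* A lower bound lies below every [v n] simultaneously a.e., hence below their limit 0. *)
  move=> h hg; have /ae_foralln hV n : \forall x \ae mu, h x <= v n x.
    move: (hg (g n) (ex_intro2 _ _ n I erefl)) (VE n).
    by apply: filterS2 => x /= + <-.
  move: hV u0 (L00E mu); apply: filterS3 => x hx ux ->.
  have wx : w n x @[n --> \oo] --> (0 : R).
    apply: (@squeeze_cvgr _ _ _ _ (cst 0) (fun n => `|u n x|)).
    - by apply: nearW => n; rewrite le_min !normr_ge0 ge_min lexx.
    - exact: cvg_cst.
    - by apply/norm_cvg0P.
  have vx := cvg_sups wx; rewrite -(cvg_lim _ vx)//.
  by apply: limr_ge; [exact: cvgP vx|apply: nearW => n; exact: hx].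
apply/cvgr0Pnorm_lt => e e0.
have [_ [N _ <-] gN] := ocE _ Dg inf0 e e0.
(* The threshold element of the net lies below itself, so its own norm is small. *)
have {}gN : nfs_norm E (V N) < e.
  by apply: (gN (g N)); [exists N|apply: aeW => x].
exists N => // n /= Nn.
have uV : \forall x \ae mu, `|u n x| <= `|V N x|.
  move: (uf n) (VE N); apply: filterS2 => x ux ->.
  rewrite (ger0_norm (v0 _ _)); apply: le_trans (w_le_v N n x Nn).
  by rewrite le_min lexx.
have [uE uN] := bfs_ideal (VE' N) uV.
rewrite ger0_norm; first exact: le_lt_trans uN gN.
exact: (normr_ge0 (NfsType uE)).
Qed.

End order_continuity.

(** * Pointwise limits of Cesàro means *)

Section cesaro_limits.
Variable R : realType.
Local Notation LR := (lebesgueTypeR R).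
Local Notation mu := (@lebesgue01 R).

Lemma integrable_mulr_bounded (v : LR -> R) (h : {mfun LR >-> R}) :
  mu.-integrable [set: LR] (EFin \o v) -> bounded_mfun h ->
  mu.-integrable [set: LR] (EFin \o (fun t => v t * h t)).
Proof.
move=> iv [M hM].
rewrite (_ : _ \o _ = (EFin \o v) \* (EFin \o h))%E; last first.
  by apply/funext => t; rewrite /= EFinM.
apply: integrableMl; [exact: measurableT|exact: iv|exact: measurable_funPT|].
exists M; split; first exact: num_real.
by move=> N MN t _ /=; apply: le_trans (ltW MN); exact: hM.
Qed.

(** Dominated convergence on [seg s] with majorant [|v|]. *)
Lemma cesaro_fun_cvg0 (v : LR -> R) (h : nat -> {mfun LR >-> R}) s :
  mu.-integrable [set: LR] (EFin \o v) -> (forall k t, `|h k t| <= 1) ->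
  (\forall t \ae mu, h k t @[k --> \oo] --> (0 : R)) ->
  cesaro_fun (fun t => v t * h k t) s @[k --> \oo] --> (0 : R).
Proof.
move=> iv h1 h0; have mv := measurable_int _ iv.
have mseg : measurable (seg s) by exact: measurable_seg.
have ivh k : mu.-integrable [set: LR] (EFin \o (fun t => v t * h k t)).
  by apply: integrable_mulr_bounded iv _; exists 1; exact: h1.
have mf k : measurable_fun (seg s) (fun t => (v t * h k t)%:E).
  by apply: measurable_funTS; exact: measurable_int (ivh k).
have m0 : measurable_fun (seg s) (cst 0%E : LR -> \bar R).
  exact: measurable_cst.
have f0 : \forall t \ae mu, seg s t ->
    (v t * h k t)%:E @[k --> \oo] --> (0 : \bar R).
  apply: filterS h0 => t ht _; apply: cvg_EFin; first exact: nearW.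
  by rewrite -(mulr0 (v t)); exact: cvgM (cvg_cst _) ht.
have ig : mu.-integrable (seg s) (EFin \o (Num.norm \o v)).
  by apply: in_L1_seg; exact: integrable_norm.
have fg : \forall t \ae mu, forall k, seg s t ->
    (`|(v t * h k t)%:E| <= (EFin \o (Num.norm \o v)) t)%E.
  apply: aeW => t k _; rewrite /= lee_fin normrM.
  by rewrite ler_piMr.
have [_ _] := dominated_convergence mseg mf m0 f0 ig fg.
rewrite integral0 => /fine_cvg cv.
by rewrite -(mulr0 (s : R)^-1); exact: cvgM (cvg_cst _) cv.
Qed.

Lemma cesaro_rademacher_cvg0 (v : LR -> R) s :
  mu.-integrable [set: LR] (EFin \o v) ->
  cesaro_fun (fun t => v t * rademacher R n t) s @[n --> \oo] --> (0 : R).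
Proof.
move=> iv.
apply: (@rademacher_cvg0 _ (fun h => cesaro_fun (fun t => v t * h t) s)).
  move=> a f g bf bg; rewrite -cesaro_fun_lin;
    [|exact: integrable_mulr_bounded..].
  by congr cesaro_fun; apply/funext => t; rewrite mfun_linE mulrDr mulrCA.
by move=> h h1 h0; exact: cesaro_fun_cvg0.
Qed.

Lemma ler_norm_cesaro_fun (f g : LR -> R) s :
  mu.-integrable [set: LR] (EFin \o f) ->
  mu.-integrable [set: LR] (EFin \o g) ->
  (forall t, `|f t| <= g t) -> `|cesaro_fun f s| <= cesaro_fun g s.
Proof.
move=> if_ ig fg; rewrite ler_norml; apply/andP; split.
  rewrite lerNl -mulN1r -cesaro_funZ//; apply: le_cesaro_fun => //.
    rewrite (_ : _ \o _ = fun t => ((-1)%:E * (EFin \o f) t)%E).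
      exact: integrableZl.
    by apply/funext.
  by move=> t; rewrite mulN1r (le_trans _ (fg t))// -normrN ler_norm.
by apply: le_cesaro_fun => // t; rewrite (le_trans (ler_norm _)).
Qed.

End cesaro_limits.

(** * Bounded multiples in the Cesàro space *)

Section multiples.
Variables (R : realType) (E : banach_fun_space (lebesgue01 R)).
Local Notation LR := (lebesgueTypeR R).
Local Notation mu := (@lebesgue01 R).
Local Notation L0 := {mfun_ mu, LR >-> R}.
Local Notation X := (cesaro_space E).

(** The multiplier is a genuine function, so bounds on it can be used at every point. *)
Definition L0_mul (f : L0) (h : {mfun LR >-> R}) : L0 := L0_pi mu (repr f * h).

Lemma L0_mulE f h : \forall t \ae mu, L0_mul f h t = f t * h t.
Proof. exact: L0_piE. Qed.

Lemma in_L1_mul f h : in_L1 f -> bounded_mfun h -> in_L1 (L0_mul f h).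
Proof.
by move=> L1f bh; apply: in_L1_pi; exact: integrable_mulr_bounded L1f bh.
Qed.

Lemma cesaro_abs_mulE f h : \forall s \ae mu,
  cesaro_op (L0_abs (L0_mul f h)) s = cesaro_fun (fun t => `|f t| * `|h t|) s.
Proof.
apply: filterS (cesaro_absE (L0_mul f h)) => s ->.
rewrite (@eq_cesaro_fun _ (Num.norm \o repr (L0_mul f h))
  (Num.norm \o (repr f * h)))//.
  by congr cesaro_fun; apply/funext => t; rewrite /= normrM.
by apply: filterS (L0_mulE f h) => t Et; congr Num.norm; exact: Et.
Qed.

Lemma bounded_mfun_norm (h : {mfun LR >-> R}) M :
  (forall t, `|h t| <= M) -> bounded_mfun (Num.norm \o h).
Proof. by move=> hM; exists M => t /=; rewrite normr_id. Qed.

(** Absolute values on both sides give the form of domination asked for by [bfs_ideal] and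
    [order_continuous_dct]. *)
Lemma cesaro_mul_le (f : L0) (h : {mfun LR >-> R}) M : in_L1 f ->
  (forall t, `|h t| <= M) ->
  \forall s \ae mu, `|cesaro_op (L0_abs (L0_mul f h)) s| <=
    `|(M *: cesaro_op (L0_abs f) : L0) s|.
Proof.
move=> L1f hM; have iaf := in_L1_abs L1f.
move: (cesaro_abs_mulE f h) (L0ZE M (cesaro_op (L0_abs f))) (cesaro_absE f).
apply: filterS3 => s -> -> ->.
rewrite -cesaro_funZ//; apply: le_trans (ler_norm _).
apply: ler_norm_cesaro_fun.
- exact: (@integrable_mulr_bounded _ _ (Num.norm \o h)) iaf
    (bounded_mfun_norm hM).
- rewrite (_ : _ \o _ = fun t => (M%:E * (EFin \o (Num.norm \o f)) t)%E).
    exact: integrableZl.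
  exact/funext.
- move=> t; rewrite normrM !normr_id mulrC ler_wpM2r//; exact: hM.
Qed.

Lemma cesaro_mul_in f h : f \in nfs_set X -> bounded_mfun h ->
  L0_mul f h \in nfs_set X.
Proof.
move=> /cesaro_predP[L1f Cf] bh; apply/cesaro_predP; split.
  exact: in_L1_mul.
have [M hM] := bh; apply: (bfs_ideal _ (cesaro_mul_le L1f hM)).1.
by rewrite rpredZ.
Qed.

(** The Cesàro means of [|f h_k|] tend to 0 pointwise and stay below that of [|f|], so order
    continuity of [E] applies to them. *)
Lemma cesaro_norm_mul_cvg0 (f : L0) (h : nat -> {mfun LR >-> R}) :
  order_continuous E -> f \in nfs_set X -> (forall k t, `|h k t| <= 1) ->
  (\forall t \ae mu, h k t @[k --> \oo] --> (0 : R)) ->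
  nfs_norm X (L0_mul f (h k)) @[k --> \oo] --> (0 : R).
Proof.
move=> ocE /cesaro_predP[L1f Cf] h1 h0.
apply: (order_continuous_dct ocE Cf) => [k|].
  by have := cesaro_mul_le L1f (h1 k); rewrite scale1r.
have /ae_foralln := fun k => cesaro_abs_mulE f (h k).
apply: filterS => s hs; under eq_fun do rewrite hs.
apply: (@cesaro_fun_cvg0 _ _ (fun k => Num.norm \o h k)).
- exact: in_L1_abs.
- by move=> k t /=; rewrite normr_id.
- by apply: filterS h0 => t ht; exact: (iffRL (norm_cvg0P _) ht).
Qed.

End multiples.

(** * Rademacher multiples: weak nullity and norms of sums *)

Section rademacher_multiples.
Variables (R : realType) (E : banach_fun_space (lebesgue01 R)).
Local Notation LR := (lebesgueTypeR R).
Local Notation mu := (@lebesgue01 R).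
Local Notation L0 := {mfun_ mu, LR >-> R}.
Local Notation X := (cesaro_space E).
Local Notation r := (@rademacher R).

Lemma L0_mul_lin (f : L0) a (g h : {mfun LR >-> R}) :
  L0_mul f (a *: g + h) = a *: L0_mul f g + L0_mul f h.
Proof.
apply/L0P; near=> t.
have -> : (a *: L0_mul f g + L0_mul f h : L0) t =
    (a *: L0_mul f g : L0) t + L0_mul f h t by near: t; exact: L0DE.
have -> : (a *: L0_mul f g : L0) t = a * L0_mul f g t.
  by near: t; exact: L0ZE.
have -> : L0_mul f g t = f t * g t by near: t; exact: L0_mulE.
have -> : L0_mul f h t = f t * h t by near: t; exact: L0_mulE.
have -> : L0_mul f (a *: g + h) t = f t * (a *: g + h) t.
  by near: t; exact: L0_mulE.
by rewrite mfun_linE mulrDr mulrCA.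
Unshelve. all: by end_near. Qed.

Lemma norm_mul_rademacher (f : L0) n :
  nfs_norm X (L0_mul f (r n)) = nfs_norm X f.
Proof.
congr (nfs_norm E); apply/L0P.
move: (cesaro_abs_mulE f (r n)) (cesaro_absE f).
apply: filterS2 => s -> ->; congr cesaro_fun; apply/funext => t.
by rewrite normr_rademacher mulr1.
Qed.

(** The default 0 makes this total in [h]; for bounded [h] the product lies in the space and the
    default does not occur. *)
Definition mul_nfs (f : nfs_type X) (h : {mfun LR >-> R}) : nfs_type X :=
  insubd 0 (L0_mul (val f) h).

Lemma val_mul_nfs (f : nfs_type X) h : bounded_mfun h ->
  val (mul_nfs f h) = L0_mul (val f) h.
Proof. by move=> bh; rewrite insubdK//; exact: cesaro_mul_in (valP f) bh. Qed.

(** If bounded [h k] tend to 0 a.e., the products tend to 0 in norm, so continuity of [phi] supplies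
    the hypothesis of [rademacher_cvg0]. *)
Lemma weakly_null_mul_rademacher (f : nfs_type X) : order_continuous E ->
  weakly_null (fun n => mul_nfs f (r n)).
Proof.
move=> ocE phi phic.
apply: (@rademacher_cvg0 _ (fun h => phi (mul_nfs f h))).
  move=> a g h bg bh; rewrite -linearP; congr (phi _); apply: val_inj.
  rewrite [RHS]linearP /= !val_mul_nfs//; last exact: bounded_mfun_lin.
  exact: L0_mul_lin.
move=> h h1 h0; rewrite -(linear0 phi).
apply: continuous_cvg; first exact: phic.
apply/norm_cvg0P.
rewrite (_ : (fun k => _) = fun k => nfs_norm X (L0_mul (val f) (h k))).
  by apply: cesaro_norm_mul_cvg0 => //; exact: valP.
by apply/funext => k; rewrite -val_mul_nfs//; exists 1; exact: h1.
Qed.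

Definition cesaro_rademacher (f : L0) n : L0 :=
  cesaro_op (L0_mul (L0_abs f) (r n)).

Lemma cesaro_rademacherE f n : \forall s \ae mu,
  cesaro_rademacher f n s = cesaro_fun (fun t => `|f t| * r n t) s.
Proof.
have := L0_piE mu (cesaro_fun (repr (L0_mul (L0_abs f) (r n)))).
apply: filterS => s ->.
apply: (@eq_cesaro_fun _ _ ((Num.norm \o repr f) * r n)).
move: (L0_mulE (L0_abs f) (r n)) (L0_absE f).
by apply: filterS2 => t + ft; rewrite ft.
Qed.

Lemma cesaro_rademacher_le f n : in_L1 f ->
  \forall s \ae mu, `|cesaro_rademacher f n s| <= `|cesaro_op (L0_abs f) s|.
Proof.
move=> L1f; have iaf := in_L1_abs L1f.
move: (cesaro_rademacherE f n) (cesaro_absE f); apply: filterS2 => s -> ->.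
apply: le_trans (ler_norm _); apply: ler_norm_cesaro_fun => //.
  exact: integrable_mulr_bounded iaf (bounded_rademacher _ _).
by move=> t; rewrite normrM normr_id normr_rademacher mulr1.
Qed.

(** Since [|a| <= 1], the factor [1 + a r_n] is nonnegative, so the modulus of the sum is
    [|f| + a |f| r_n], which is linear in [r_n]. *)
Lemma cesaro_abs_add_rademacher (f : L0) a n : in_L1 f -> `|a| <= 1 ->
  cesaro_op (L0_abs (f + a *: L0_mul f (r n))) =
  cesaro_op (L0_abs f) + a *: cesaro_rademacher f n.
Proof.
move=> L1f a1; have iaf := in_L1_abs L1f.
apply/L0P; near=> s.
have -> : (cesaro_op (L0_abs f) + a *: cesaro_rademacher f n : L0) s =
    cesaro_op (L0_abs f) s + (a *: cesaro_rademacher f n : L0) s.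
  by near: s; exact: L0DE.
have -> : (a *: cesaro_rademacher f n : L0) s = a * cesaro_rademacher f n s.
  by near: s; exact: L0ZE.
have -> : cesaro_rademacher f n s = cesaro_fun (fun t => `|f t| * r n t) s.
  by near: s; exact: cesaro_rademacherE.
have -> : cesaro_op (L0_abs f) s = cesaro_fun (Num.norm \o f) s.
  by near: s; exact: cesaro_absE.
have -> : cesaro_op (L0_abs (f + a *: L0_mul f (r n))) s =
    cesaro_fun (Num.norm \o (f + a *: L0_mul f (r n) : L0)) s.
  by near: s; exact: cesaro_absE.
rewrite [RHS]addrC -cesaro_fun_lin//; last first.
  exact: integrable_mulr_bounded iaf (bounded_rademacher _ _).
pose nf : {mfun LR >-> R} := Num.norm \o repr f.
apply: (@eq_cesaro_fun _ (Num.norm \o repr (f + a *: L0_mul f (r n)))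
  (a *: (nf * r n) + nf)).
near=> t; rewrite mfun_linE.
suff ft : (f + a *: L0_mul f (r n) : L0) t = f t * (1 + a * r n t).
  apply: (etrans (congr1 Num.norm ft)).
  rewrite normrM [X in _ * X]ger0_norm.
    by rewrite mulrDr mulr1 addrC mulrCA.
  rewrite -lerBlDl sub0r.
  have : `|a * r n t| <= 1 by rewrite normrM normr_rademacher mulr1.
  by rewrite ler_norml => /andP[].
have -> : (f + a *: L0_mul f (r n) : L0) t =
    f t + (a *: L0_mul f (r n) : L0) t by near: t; exact: L0DE.
have -> : (a *: L0_mul f (r n) : L0) t = a * L0_mul f (r n) t.
  by near: t; exact: L0ZE.
have -> : L0_mul f (r n) t = f t * r n t by near: t; exact: L0_mulE.
by rewrite mulrDr mulr1 mulrCA.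
Unshelve. all: by end_near. Qed.

(** The norm is that of [c + a *: u n] in [E], where [u n] tends to 0 in norm. *)
Lemma norm_add_mul_rademacher (f : nfs_type X) a :
  order_continuous E -> `|a| <= 1 ->
  `|f + a *: mul_nfs f (r n)| @[n --> \oo] --> (`|f| : R).
Proof.
move=> ocE a1; have /cesaro_predP[L1f Cf] := valP f.
have UC n := cesaro_rademacher_le n L1f.
have UinE n : cesaro_rademacher (val f) n \in nfs_set E.
  exact: (bfs_ideal Cf (UC n)).1.
pose u n : nfs_type E := NfsType (UinE n).
pose c : nfs_type E := NfsType Cf.
have u0 : u n @[n --> \oo] --> (0 : nfs_type E).
  apply/norm_cvg0P; apply: (order_continuous_dct ocE Cf UC).
  have /ae_foralln := cesaro_rademacherE (val f).
  apply: filterS => s Us; under eq_fun do rewrite Us.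
  by apply: cesaro_rademacher_cvg0; exact: in_L1_abs.
rewrite (_ : (fun n => _) = fun n => `|c + a *: u n|).
  apply: (@cvg_norm _ _ _ _ _ (fun n => c + a *: u n) c).
  have : c + a *: u n @[n --> \oo] --> c + a *: (0 : nfs_type E).
    exact: (cvgD (cvg_cst c) (@cvgZl_tmp _ _ _ _ _ a _ _ u0)).
  by rewrite scaler0 addr0.
apply/funext => n; congr (nfs_norm E _).
have vf : val (f + a *: mul_nfs f (r n)) =
    val f + a *: L0_mul (val f) (r n).
  by rewrite addrC linearP addrC /= val_mul_nfs//; exact: bounded_rademacher.
have vc : val (c + a *: u n) = val c + a *: cesaro_rademacher (val f) n.
  by rewrite addrC linearP addrC.
by rewrite vc -cesaro_abs_add_rademacher// -vf.
Qed.

End rademacher_multiples.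

(** * Rademacher multiples of a unit vector as the required sequence *)

Theorem corollary2p3 (R : realType) (E : banach_fun_space (lebesgue01 R)) :
  order_continuous E -> rearrangement_invariant E ->
  wasq (nfs_type (cesaro_space E)).
Proof.
move=> ocE _ x x1.
have nx n : `|mul_nfs x (rademacher R n)| = 1.
  apply: (etrans _ x1); apply: (etrans _ (norm_mul_rademacher E (val x) n)).
  by rewrite -val_mul_nfs//; exact: bounded_rademacher.
exists (fun n => mul_nfs x (rademacher R n)); split.
- exact: weakly_null_mul_rademacher.
- by move=> n; rewrite nx.
(* The two signs are the cases [a = 1] and [a = -1] of [norm_add_mul_rademacher]. *)
- rewrite -x1; under eq_fun do rewrite -[mul_nfs _ _]scale1r.
  by apply: norm_add_mul_rademacher; rewrite ?normr1.
- rewrite -x1; under eq_fun do rewrite -scaleN1r.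
  by apply: norm_add_mul_rademacher; rewrite ?normrN1.
- by under eq_fun do rewrite nx; exact: cvg_cst.
Qed.
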